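(* Let $p$ be an odd prime and let $(s_u)_{u\ge 0}$ be the $2p$-periodic quaternary sequence over $\mathbb{Z}_4$ defined by $$ s_u=\begin{cases} 0, & \text{if } u \bmod 2p=0 \text{ or } u \bmod 2p\in D_0,\\ 1, & \text{if } u \bmod 2p\in D_1,\\ 2, & \text{if } u \bmod 2p=p \text{ or } u \bmod 2p\in E_0,\\ 3, & \text{if } u \bmod 2p\in E_1. \end{cases} $$ Then the linear complexity of $(s_u)_{u\ge 0}$ over $\mathbb{Z}_4$ satisfies $$ LC((s_u)_{u\ge 0})=\begin{cases} (p+1)/2, & \text{if } p\equiv -9 \pmod{16},\\ (p+3)/2, & \text{if } p\equiv 9 \pmod{16}. \end{cases} $$
   Context: Let $p$ be an odd prime and let $g$ be an odd integer that is a primitive root both modulo $p$ and modulo $2p$. Write $\mathbb{Z}_{2p}=\{0,1,\ldots,2p-1\}$ for the residue class ring modulo $2p$ and put $$D_0=\{g^{2n} \bmod 2p : 0\le n\le (p-3)/2\},\qquad D_1=\{g^{2n+1} \bmod 2p : 0\le n\le (p-3)/2\},$$ and $E_i=\{2u \bmod 2p : u\in D_i\}$ for $i=0,1$. Then $\mathbb{Z}_{2p}$ is the disjoint union $D_0\cup D_1\cup E_0\cup E_1\cup\{0,p\}$. $\mathbb{Z}_4=\{0,1,2,3\}$ is the residue class ring modulo $4$. The linear complexity $LC((s_u)_{u\ge0})$ of a sequence over $\mathbb{Z}_4$ is the least $L$ for which there exist $c_1,\ldots,c_L\in\mathbb{Z}_4$ with $s_{u+L}+c_1s_{u+L-1}+\cdots+c_{L-1}s_{u+1}+c_Ls_u=0$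 for all $u\ge 0$. *)

(* Defs.v *)
From mathcomp Require Import all_boot all_order all_algebra.

Set Implicit Arguments.
Unset Strict Implicit.
Unset Printing Implicit Defensive.

Import GRing.Theory.
Local Open Scope ring_scope.

(* The multiplicative order of g modulo m is exactly phi(m); to be used with
   1 < m, where 'Z_m really is the ring of integers modulo m. *)
Definition primitive_root_mod (m : nat) (g : int) : Prop :=
  (totient m).-primitive_root (g%:~R : 'Z_m).

(* The index n : 'I_((p - 3)./2.+1) ranges over 0 <= n <= (p - 3) / 2. *)
Definition classD (p : nat) (g : int) (i : nat) : {set 'Z_(2 * p)} :=
  [set (g%:~R : 'Z_(2 * p)) ^+ (2 * n + i) | n : 'I_((p - 3)./2.+1)].

Definition classE (p : nat) (g : int) (i : nat) : {set 'Z_(2 * p)} :=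
  [set 2%:R * u | u in classD p g i].

(* When p is an odd prime and g an odd primitive root modulo p and 2p, the
   classes D_0, D_1, E_0, E_1 and {0, p} partition 'Z_(2 * p): the branches are
   mutually exclusive and the final default is never reached. *)
Definition quaternary_seq (p : nat) (g : int) (u : nat) : 'Z_4 :=
  let x : 'Z_(2 * p) := u%:R in
  if (x == 0) || (x \in classD p g 0) then 0
  else if x \in classD p g 1 then 1
  else if (x == p%:R) || (x \in classE p g 0) then 2%:R
  else if x \in classE p g 1 then 3%:R
  else 0.

(* Only c 1, ..., c L matter, and i <= L keeps u + L - i from truncating. *)
Definition has_linear_recurrence (R : nzRingType) (s : nat -> R) (L : nat) :
    Prop :=
  exists c : nat -> R, forall u : nat,
    s (u + L)%N + \sum_(1 <= i < L.+1) c i * s (u + L - i)%N = 0.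

Definition is_linear_complexity (R : nzRingType) (s : nat -> R) (L : nat) :
    Prop :=
  has_linear_recurrence s L /\
  forall L' : nat, has_linear_recurrence s L' -> (L <= L')%N.

(* Main.v *)
Require Import Defs.
From mathcomp Require Import all_boot all_order all_algebra all_field.
From mathcomp Require Import ring zify.

(* Put d = (p - 1) / 2.  As 2 is a square modulo p, modulo 4 the sequence is
   u |-> a u + b u, where a is p-periodic, vanishes at the trivial frequency and
   depends only on the quadratic character of u, while b = 2 [u odd] if
   p = 9 mod 16 and b = (-1)^u if p = 7 mod 16.  Evaluating the Jacobi sum shows
   that - a is idempotent for cyclic convolution modulo 4.  Over an algebraic
   closure of F_2 its Fourier transform therefore takes only the values 0 and 1;
   multiplying the frequency by a nonresidue exchanges the two values, so a has
   exactly d nonzero frequencies, none of them trivial.  The gcd of X ^ p - 1 and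
   1 - P, with P the idempotent, is then an annihilator of a modulo 2 of degree
   d, which lifts to a monic annihilator modulo 4, and multiplying it by X ^ 2 - 1
   or X + 1 kills b too.  Conversely the characteristic polynomial of a recurrence
   vanishes modulo 2 at the d frequencies of a and also, doubly if p = 9 mod 16,
   at 1. *)

Set Implicit Arguments.
Unset Strict Implicit.
Unset Printing Implicit Defensive.

Import GRing.Theory.
Local Open Scope ring_scope.

(** * Shift action of polynomials on sequences *)

Section ShiftAction.
Variable R : comNzRingType.
Implicit Types (f g : {poly R}) (s t : nat -> R).

(** Sequences become a module over the polynomial ring, ['X] acting as the shift. A monic polynomial
    that acts as zero is a characteristic polynomial of a linear recurrence. *)
Definition shift_act f s (u : nat) : R := \sum_(i < size f) f`_i * s (u + i)%N.

Lemma shift_act_wide n f s u : (size f <= n)%N ->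
  shift_act f s u = \sum_(i < n) f`_i * s (u + i)%N.
Proof.
move=> le_fn; rewrite /shift_act (big_ord_widen _ (fun i => f`_i * s (u + i)%N) le_fn).
rewrite big_mkcond; apply: eq_bigr => i _.
by case: ltnP => // le_fi; rewrite nth_default ?mul0r.
Qed.

Lemma shift_actD f g s u :
  shift_act (f + g) s u = shift_act f s u + shift_act g s u.
Proof.
rewrite !(@shift_act_wide (maxn (size f) (size g))) ?leq_maxl ?leq_maxr ?size_polyD //.
by rewrite -big_split; apply: eq_bigr => i _; rewrite coefD mulrDl.
Qed.

Lemma shift_actZ c f s u : shift_act (c *: f) s u = c * shift_act f s u.
Proof.
rewrite (@shift_act_wide (size f)) ?size_scale_leq // mulr_sumr.
by apply: eq_bigr => i _; rewrite coefZ mulrA.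
Qed.

Lemma shift_act0 s u : shift_act 0 s u = 0.
Proof. by rewrite -[X in shift_act X](scale0r 0) shift_actZ mul0r. Qed.

Lemma shift_act_sum I (r : seq I) (F : I -> {poly R}) s u :
  shift_act (\sum_(i <- r) F i) s u = \sum_(i <- r) shift_act (F i) s u.
Proof.
apply: (big_morph (fun f => shift_act f s u)); first by move=> f g; exact: shift_actD.
exact: shift_act0.
Qed.

Lemma shift_actMX f s u : shift_act (f * 'X) s u = shift_act f s u.+1.
Proof.
rewrite (@shift_act_wide (size f).+1) ?(leq_trans (size_polyMleq _ _)) ?size_polyX ?addn2 //.
rewrite big_ord_recl coefMX mul0r add0r; apply: eq_bigr => i _.
by rewrite coefMX /= addSnnS.
Qed.

Lemma shift_act1 s u : shift_act 1 s u = s u.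
Proof. by rewrite /shift_act size_poly1 big_ord1 coef1 mul1r addn0. Qed.

Lemma shift_actXn n s u : shift_act 'X^n s u = s (u + n)%N.
Proof.
elim: n u => [|n IHn] u; first by rewrite shift_act1 addn0.
by rewrite exprSr shift_actMX IHn addSnnS.
Qed.

Lemma eq_shift_act f s t u : s =1 t -> shift_act f s u = shift_act f t u.
Proof. by move=> eq_st; apply: eq_bigr => i _; rewrite eq_st. Qed.

(** Since polynomials commute, either factor may act first, so a product annihilates whatever one of
    its factors annihilates. *)
Lemma shift_actM f g s u : shift_act (f * g) s u = shift_act f (shift_act g s) u.
Proof.
elim/poly_ind: f u => [|f c IHf] u; first by rewrite mul0r !shift_act0.
rewrite mulrDl mulrAC mul_polyC !shift_actD !shift_actMX IHf shift_actZ.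
by rewrite -[c%:P]mulr1 mul_polyC shift_actZ shift_act1.
Qed.

Lemma shift_act_addr f s t u :
  shift_act f (fun v => s v + t v) u = shift_act f s u + shift_act f t u.
Proof. by rewrite -big_split; apply: eq_bigr => i _; rewrite mulrDr. Qed.

Lemma shift_act_mulr f c s u :
  shift_act f (fun v => c * s v) u = c * shift_act f s u.
Proof. by rewrite mulr_sumr; apply: eq_bigr => i _; rewrite mulrCA. Qed.

End ShiftAction.

Lemma shift_act_dvd (m : int) (f : {poly int}) (s : nat -> int) u :
  (forall v, (m %| s v)%Z) -> (m %| shift_act f s u)%Z.
Proof. by move=> dvs; apply: rpred_sum => i _; apply: dvdz_mull. Qed.

(** * Additive characters of the prime field *)

Section PrimeField.
Variable p : nat.
Hypothesis p_pr : prime p.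

Lemma natr_Fp_eq (m n : nat) : (m%:R == n%:R :> 'F_p) = (m == n %[mod p]).
Proof. by rewrite -val_eqE /= !val_Fp_nat. Qed.

Lemma natr_Fp_val (y : 'F_p) : (nat_of_ord y)%:R = y.
Proof. exact: natr_Zp. Qed.

Section AddChar.
Variables (K : fieldType) (z : K).
Hypothesis z_prim : p.-primitive_root z.

Definition addchar (y : 'F_p) : K := z ^+ (y : nat).

Lemma addchar_nat m : addchar m%:R = z ^+ m.
Proof. by rewrite /addchar val_Fp_nat // prim_expr_mod. Qed.

Lemma addcharD x y : addchar (x + y) = addchar x * addchar y.
Proof. by rewrite -[x]natr_Fp_val -[y]natr_Fp_val -natrD !addchar_nat exprD. Qed.

Lemma addcharMn x m : addchar (x * m%:R) = addchar x ^+ m.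
Proof. by rewrite -[x]natr_Fp_val -natrM !addchar_nat exprM. Qed.

Lemma addchar0 : addchar 0 = 1. Proof. by rewrite (addchar_nat 0). Qed.

Lemma addchar_inj : injective addchar.
Proof.
move=> x y; rewrite -[x]natr_Fp_val -[y]natr_Fp_val !addchar_nat => /eqP.
by rewrite (eq_prim_root_expr z_prim) -natr_Fp_eq => /eqP.
Qed.

Lemma addchar_expp x : addchar x ^+ p = 1.
Proof. by rewrite -exprM mulnC exprM (prim_expr_order z_prim) expr1n. Qed.

(** After rescaling to frequency 1, translating [y] by 1 multiplies the sum by [addchar 1], which
    differs from 1. *)
Lemma sum_addchar k : k != 0 -> \sum_(y : 'F_p) addchar (k * y) = 0.
Proof.
move=> nz_k; rewrite (reindex_inj (mulfI (invr_neq0 nz_k))) /=.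
under eq_bigr => y _ do rewrite mulVKf //.
have nz1 : addchar 1 != 1 by rewrite -addchar0 (inj_eq addchar_inj) oner_eq0.
apply: (mulfI (_ : addchar 1 - 1 != 0)); first by rewrite subr_eq0.
rewrite mulr0 mulrBl mul1r mulr_sumr [X in _ - X](reindex_inj (addrI 1)) /=.
by apply/eqP; rewrite subr_eq0; apply/eqP/eq_bigr => y _; rewrite addcharD.
Qed.

End AddChar.
End PrimeField.

(** * Roots of unity and the quadratic character of 2 *)

Lemma prime_primitive_root (p : nat) (K : closedFieldType) :
  prime p -> p%:R != 0 :> K -> exists z : K, p.-primitive_root z.
Proof.
move=> p_pr nz_p.
have sz : size (\sum_(i < p) 'X^i : {poly K}) = p.
  have -> : \sum_(i < p) 'X^i = \poly_(i < p) 1 :> {poly K}.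
    by rewrite poly_def; apply: eq_bigr => i _; rewrite scale1r.
  by rewrite size_poly_eq ?oner_neq0.
have /closed_rootP[z /rootP z_root] : size (\sum_(i < p) 'X^i : {poly K}) != 1.
  by rewrite sz; case: eqP p_pr => // ->.
have {}z_root : \sum_(i < p) z ^+ i = 0.
  by rewrite -[RHS]z_root horner_sum; apply: eq_bigr => i _; rewrite hornerXn.
have zp : z ^+ p = 1.
  by apply/eqP; rewrite -subr_eq0 subrX1 z_root mulr0.
have [m m_prim] := prim_order_exists (prime_gt0 p_pr) zp.
move: m_prim => m_prim m_dvd; exists z.
(* The order of [z] divides [p]; order 1 would turn the equation for [z] into [p = 0] in [K]. *)
case/primeP: p_pr => _ /(_ m m_dvd) /orP[/eqP m1|/eqP <- //].
move: z_root nz_p; rewrite -[z]expr1 -m1 (prim_expr_order m_prim).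
under eq_bigr do rewrite expr1n.
by rewrite sumr_const card_ord => ->; rewrite eqxx.
Qed.

(* If zeta ^ 4 = -1 then (zeta + zeta^-1) ^ 2 = 2, and Frobenius fixes
   zeta + zeta^-1 when p = +-1 mod 8. *)
Lemma two_quadratic_residue (p : nat) : prime p -> odd p ->
  (p %% 8 == 1)%N || (p %% 8 == 7)%N -> 2%:R ^+ p./2 = 1 :> 'F_p.
Proof.
move=> p_pr p_odd p8.
have [K [iota _]] := countable_algebraic_closure 'F_p.
have pK : p \in [pchar K] by rewrite (fmorph_pchar iota) pchar_Fp.
apply: (fmorph_inj iota); rewrite rmorphXn rmorph_nat rmorph1.
have /closed_rootP[z] : size ('X^4 + 1 : {poly K}) != 1.
  by rewrite -[1]/(1%:P) size_polyDl ?size_polyXn ?size_polyC ?oner_neq0.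
rewrite /root hornerD hornerXn hornerC addr_eq0 => /eqP z4.
have nz_z : z != 0.
  by apply: contra_eq_neq z4 => ->; rewrite expr0n eq_sym oppr_eq0 oner_eq0.
have z8 : z ^+ 8 = 1 by rewrite (exprM z 4 2) z4 sqrrN expr1n.
pose y := z + z^-1.
have y2 : y ^+ 2 = 2%:R.
  apply: (mulfI (expf_neq0 2 nz_z)); rewrite -exprMn mulrDr mulfV //.
  by rewrite -expr2 sqrrD1 -exprM z4 addrAC addNr add0r mulr_natr.
have zp : z ^+ p = z ^+ (p %% 8).
  by rewrite {1}(divn_eq p 8) exprD mulnC exprM z8 expr1n mul1r.
have yp : y ^+ p = y.
  rewrite -(pFrobenius_autE pK) rmorphD fmorphV /= pFrobenius_autE zp.
  case/orP: p8 => /eqP->; first by rewrite expr1.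
  have -> : z ^+ 7 = z^-1 by apply: (mulfI nz_z); rewrite -exprS z8 mulfV.
  by rewrite invrK addrC.
have nz_y : y != 0.
  apply: contraTneq p_odd => y0; move/eqP: y2; rewrite y0 expr0n eq_sym /=.
  by rewrite -(dvdn_pcharf pK) dvdn_prime2 // => /eqP->.
apply: (mulfI nz_y); rewrite -y2 -exprM -exprS mulr1 -[RHS]yp.
by rewrite -[in RHS](odd_double_half p) p_odd mul2n.
Qed.

(** * Quadratic character *)

Section QuadraticCharacter.
Variable p : nat.
Hypotheses (p_pr : prime p) (p_odd : odd p).

(** The Legendre symbol through Euler's criterion. Integer values allow character sums to be
    evaluated exactly before reducing modulo 4. *)
Definition qchar (y : 'F_p) : int :=
  if y == 0 then 0 else if y ^+ p./2 == 1 then 1 else -1.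

Lemma Fp_expf_half (y : 'F_p) : y != 0 -> y ^+ p./2 = 1 \/ y ^+ p./2 = -1.
Proof.
move=> nz_y; have: (y ^+ p./2) ^+ 2 == 1.
  rewrite -exprM muln2; have -> : (p./2.*2 = p.-1)%N.
    by rewrite -[in RHS](odd_double_half p) p_odd.
  apply/eqP/(mulfI nz_y); rewrite mulr1 -exprS prednK ?prime_gt0 //.
  by have := expf_card y; rewrite card_Fp.
by rewrite sqrf_eq1 => /orP[] /eqP; [left | right].
Qed.

Lemma Fp_oppr1_neq1 : -1 != 1 :> 'F_p.
Proof.
rewrite -subr_eq0 -opprD oppr_eq0 -[1 + 1](natrD _ 1 1) -(dvdn_pcharf (pchar_Fp p_pr)).
by rewrite dvdn_prime2 //; apply: contraTneq p_odd => ->.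
Qed.

Lemma qchar0 : qchar 0 = 0. Proof. by rewrite /qchar eqxx. Qed.

Lemma qcharM x y : qchar (x * y) = qchar x * qchar y.
Proof.
rewrite /qchar mulf_eq0; case: (eqVneq x 0) => [|nz_x] /=; first by rewrite mul0r.
case: (eqVneq y 0) => [|nz_y] /=; first by rewrite mulr0.
rewrite exprMn.
have [->|->] := Fp_expf_half nz_x; have [->|->] := Fp_expf_half nz_y;
  by rewrite ?mulN1r ?mul1r ?opprK ?eqxx ?(negPf Fp_oppr1_neq1).
Qed.

Lemma qchar1 : qchar 1 = 1.
Proof. by rewrite /qchar oner_eq0 expr1n eqxx. Qed.

Lemma qchar_cases y : y != 0 -> qchar y = 1 \/ qchar y = -1.
Proof. by rewrite /qchar => /negPf->; case: ifP; [left | right]. Qed.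

Lemma qchar_sqr y : y != 0 -> qchar y * qchar y = 1.
Proof. by rewrite /qchar => /negPf->; case: ifP. Qed.

Lemma qcharV y : qchar y^-1 = qchar y.
Proof.
case: (eqVneq y 0) => [->|nz_y]; first by rewrite invr0.
have: qchar (y * y^-1) = 1 by rewrite mulfV ?qchar1.
by rewrite qcharM -{1}(qchar_sqr nz_y) => /mulfI ->//; rewrite /qchar (negPf nz_y); case: ifP.
Qed.

Lemma qcharN1 : qchar (-1) = (-1) ^+ p./2.
Proof.
rewrite /qchar oppr_eq0 oner_eq0 -![(-1) ^+ p./2]signr_odd.
by case: (odd _); rewrite ?eqxx ?(negPf Fp_oppr1_neq1).
Qed.

Variable g : 'F_p.
Hypothesis g_nonres : qchar g = -1.

Lemma nonres_neq0 : g != 0.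
Proof. by apply: contra_eq_neq g_nonres => ->; rewrite qchar0. Qed.

Lemma sum_qchar : \sum_y qchar y = 0.
Proof.
have: \sum_y qchar y = - \sum_y qchar y.
  rewrite {1}(reindex_inj (mulfI nonres_neq0)) -sumrN.
  by apply: eq_bigr => y _; rewrite qcharM g_nonres mulN1r.
by lia.
Qed.

Lemma sum_Fp1 : \sum_(y : 'F_p) 1 = p%:Z.
Proof. by rewrite sumr_const card_Fp ?natz. Qed.

Lemma sum_FpF (F : 'F_p -> int) : \sum_y F y = F 0 + \sum_(y | y != 0) F y.
Proof. by rewrite (bigD1 0). Qed.

(** For [w = 0] every nonzero [y] contributes [qchar (-1)]. Otherwise put [y = w / (1 + c)], so that
    [w - y = c * y] and the term becomes [qchar c]; here [c] runs over everything but -1, and the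
    full character sum is zero. *)
Lemma jacobi_sum (w : 'F_p) :
  \sum_y qchar y * qchar (w - y) = qchar (-1) * (p%:Z * (w == 0)%:R - 1).
Proof.
have [->|nz_w] := eqVneq w 0.
  rewrite -sum_Fp1 !sum_FpF mulr1 [_ - 1]addrC addKr qchar0 mul0r add0r mulr_sumr.
  by apply: eq_bigr => y nz_y; rewrite sub0r -[- y]mulN1r qcharM mulrCA qchar_sqr ?mulr1.
rewrite [p%:Z * _]mulr0 sub0r mulrN1 sum_FpF qchar0 mul0r add0r.
have := sum_qchar; rewrite (bigD1 (-1)) //= => /eqP; rewrite addrC addr_eq0 => /eqP <-.
have nz_Bw y : (- (1 : 'F_p) != y) -> 1 + y != 0.
  by apply: contraNneq => y1; rewrite -[y](addKr 1) y1 addr0.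
rewrite (reindex_onto (fun c => w / (1 + c)) (fun y => w / y - 1)) => [|y nz_y] /=.
  rewrite (eq_bigl (fun c => c != -1)) => [|c]; last first.
    have [->|nz_c] := eqVneq c (-1); first by rewrite subrr invr0 mulr0 eqxx.
    rewrite eq_sym in nz_c; have := nz_Bw _ nz_c => nz_c1.
    rewrite mulf_neq0 ?invr_eq0 //= invf_div mulrCA divff // mulr1 addrC addKr.
    by rewrite eqxx.
  apply: eq_bigr => c; rewrite eq_sym => /nz_Bw nz_c1.
  have -> : w - w / (1 + c) = w / (1 + c) * c by field.
  by rewrite [qchar (_ * c)]qcharM mulrA qchar_sqr ?mul1r // mulf_neq0 ?invr_eq0.
by rewrite addrC subrK invf_div mulrCA divff ?mulr1.
Qed.

End QuadraticCharacter.

(** * Convolution modulo 4 *)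

Section CyclicIdeal.
Variable p : nat.
Hypothesis p_pr : prime p.

(* The ideal (4, X ^ p - 1) of Z[X]. *)
Definition cyclic4 (f : {poly int}) : Prop :=
  exists q r : {poly int}, f = q * ('X^p - 1) + 4%:R * r.

Lemma cyclic4_0 : cyclic4 0.
Proof. by exists 0, 0; rewrite mul0r mulr0 addr0. Qed.

Lemma cyclic4D f g : cyclic4 f -> cyclic4 g -> cyclic4 (f + g).
Proof. by move=> [q [r ->]] [q' [r' ->]]; exists (q + q'), (r + r'); ring. Qed.

Lemma cyclic4Ml h f : cyclic4 f -> cyclic4 (h * f).
Proof. by move=> [q [r ->]]; exists (h * q), (h * r); ring. Qed.

Lemma cyclic4_sum I (r : seq I) (F : I -> {poly int}) :
  (forall i, cyclic4 (F i)) -> cyclic4 (\sum_(i <- r) F i).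
Proof.
move=> F4; elim: r => [|i r IHr]; first by rewrite big_nil; exact: cyclic4_0.
by rewrite big_cons; exact: cyclic4D.
Qed.

Lemma cyclic4_Xn m : cyclic4 ('X^m - 'X^(m %% p)).
Proof.
exists ('X^(m %% p) * \sum_(i < m %/ p) ('X^p) ^+ i), 0.
rewrite mulr0 addr0 {1}(divn_eq m p) exprD mulnC exprM -mulrA [_ * ('X^p - 1)]mulrC.
by rewrite -subrX1 mulrBr mulr1 mulrC.
Qed.

(* Modulo X ^ p - 1 and up to sign, multiplying by this polynomial is taking
   correlations with a. *)
Definition corr_poly (a : 'F_p -> int) : {poly int} :=
  \sum_y (- a (- y)) *: 'X^(y : nat).

(** Modulo ['X^p - 1] the square of [P] has as coefficients the self-convolution of [a] at [- w].
    The sign in [P] turns the coefficients of the difference into the sums of the hypothesis. *)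
Lemma corr_poly_idem (a : 'F_p -> int) :
  (forall w, (4 %| \sum_y a y * a (w - y) + a w)%Z) ->
  cyclic4 (corr_poly a * corr_poly a - corr_poly a).
Proof.
move=> a_conv; set P := corr_poly a.
have PP : P * P = \sum_x \sum_y (a (- x) * a (- y)) *: 'X^((x : nat) + y)%N.
  rewrite big_distrlr; apply: eq_bigr => x _; apply: eq_bigr => y _ /=.
  by rewrite -scalerAl -scalerAr scalerA mulrNN exprD.
(* [Q] is [P * P] with its exponents reduced modulo [p]. *)
pose Q := \sum_(w : 'F_p) (\sum_x a (- x) * a (- (w - x))) *: 'X^(w : nat) : {poly int}.
have QE : Q = \sum_x \sum_y (a (- x) * a (- y)) *: 'X^((x + y)%R : nat).
  rewrite /Q; under eq_bigr => w _ do rewrite scaler_suml.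
  rewrite exchange_big; apply: eq_bigr => x _.
  rewrite (reindex_inj (addrI x)); apply: eq_bigr => y _ /=.
  by rewrite [x + y]addrC addrK.
have -> : P * P - P = (P * P - Q) + (Q - P) by rewrite addrA subrK.
apply: cyclic4D.
  rewrite PP QE -sumrB; apply: cyclic4_sum => x; rewrite -sumrB.
  apply: cyclic4_sum => y; rewrite -scalerBr -mul_polyC; apply: cyclic4Ml.
  have -> : nat_of_ord (x + y) = (((x : nat) + y) %% p)%N
      by rewrite -val_Fp_nat // natrD !natr_Fp_val.
  exact: cyclic4_Xn.
rewrite -sumrB; apply: cyclic4_sum => w; rewrite -scalerBl opprK.
have -> : \sum_x a (- x) * a (- (w - x)) = \sum_y a y * a (- w - y).
  rewrite [RHS](reindex_inj oppr_inj); apply: eq_bigr => y _ /=.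
  by rewrite opprB opprK addrC.
have /dvdzP[c ->] := a_conv (- w).
exists 0, (c *: 'X^(w : nat)); rewrite mul0r add0r mulr_natl [c * _]mulrC -scalerA.
by rewrite scaler_nat.
Qed.

Lemma shift_act_corr_poly (a : 'F_p -> int) u :
  shift_act (corr_poly a) (fun v => (v%:R == 0 :> 'F_p)%:R) u = - a u%:R.
Proof.
rewrite shift_act_sum (bigD1 (- u%:R)) // big1 => [|y ny]; last first.
  rewrite shift_actZ shift_actXn natrD natr_Fp_val addrC addr_eq0 (negPf ny).
  by rewrite mulr0.
by rewrite shift_actZ shift_actXn natrD natr_Fp_val subrr eqxx opprK mulr1 [LHS]addr0.
Qed.

(** Up to sign, [a] is [corr_poly a] acting on the indicator [delta] of the multiples of [p]. There
    ['X^p - 1] acts as zero by periodicity, and [4 * r] gives multiples of 4. *)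
Lemma cyclic4_annihil (a : 'F_p -> int) M :
  cyclic4 (M * corr_poly a) ->
  forall u, (4 %| shift_act M (fun v => a v%:R) u)%Z.
Proof.
move=> [q [r MP]] u; pose delta v : int := (v%:R == 0 :> 'F_p)%:R.
have -> : shift_act M (fun v => a v%:R) u = - shift_act (M * corr_poly a) delta u.
  rewrite shift_actM -mulN1r -shift_act_mulr; apply: eq_shift_act => v.
  by rewrite shift_act_corr_poly mulN1r opprK.
rewrite MP shift_actD shift_actM rpredN rpredD //.
  apply: shift_act_dvd => v; rewrite -scaleN1r shift_actD shift_actZ shift_act1.
  rewrite shift_actXn /delta natrD (pcharf0 (pchar_Fp p_pr)).
  by rewrite addr0 mulN1r subrr.
by rewrite mulr_natl -scaler_nat shift_actZ dvdz_mulr.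
Qed.

End CyclicIdeal.

(** * Frequencies in characteristic 2 *)

Section LiftF2.
Implicit Types q : {poly 'F_2}.

Definition lift_poly q : {poly int} := \poly_(i < size q) (nat_of_ord q`_i)%:Z.

Lemma map_lift_poly q : map_poly intr (lift_poly q) = q.
Proof.
apply/polyP => i; rewrite coef_map coef_poly /=.
case: ltnP => [_|le_qi]; first by rewrite -pmulrn natr_Fp_val.
by rewrite nth_default.
Qed.

Lemma lift_poly_monic q : q \is monic -> lift_poly q \is monic.
Proof.
move=> q_mon; have nz_q := monic_neq0 q_mon.
have lc : (nat_of_ord q`_(size q).-1)%:Z = 1.
  by rewrite -lead_coefE (monicP q_mon).
by rewrite monicE lead_coef_poly ?lc // size_poly_gt0.
Qed.

Lemma size_lift_poly q : size (lift_poly q) = size q.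
Proof.
apply/eqP; rewrite eqn_leq size_poly -{1}[q]map_lift_poly.
exact: size_poly.
Qed.

Lemma map_poly_F2_eq0 (f : {poly int}) :
  map_poly intr f = 0 :> {poly 'F_2} -> exists h, f = 2%:R * h.
Proof.
move=> f0; exists (\poly_(i < size f) (f`_i %/ 2)%Z).
apply/polyP => i; rewrite mulr_natl coefMn coef_poly.
case: ltnP => [_|le_fi]; last by rewrite nth_default ?mul0rn.
have: (2 %| f`_i)%Z.
  rewrite (dvdz_pcharf (pchar_Fp (isT : prime 2))).
  by move/polyP/(_ i): f0; rewrite coef_map coef0 => ->.
lia.
Qed.

Lemma monic_F2 q : q != 0 -> q \is monic.
Proof.
rewrite monicE -lead_coef_eq0; case: (lead_coef q) => [[|[|?]]] //= ?.
Qed.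

End LiftF2.

(** * Spectrum modulo 2 of an idempotent and sizes of annihilators *)

Section Core.
Variables (p : nat) (K : closedFieldType) (iota : {rmorphism 'F_2 -> K}) (z : K).
Hypotheses (p_pr : prime p) (p_odd : odd p) (z_prim : p.-primitive_root z).
Variables (a : 'F_p -> int) (g : 'F_p).
(* [- a] is idempotent for cyclic convolution modulo 4. *)
Hypothesis a_conv : forall w, (4 %| \sum_y a y * a (w - y) + a w)%Z.
Hypothesis a_twist : forall y, y != 0 -> (2 %| a y + a (g * y) - 1)%Z.
Hypothesis a_sum : (2 %| \sum_y a y)%Z.
Hypothesis g_neq0 : g != 0.

Local Notation psi := (@addchar p K z).
Local Notation P := (corr_poly a).

Lemma pcharK2 : 2 \in [pchar K].
Proof. by rewrite (fmorph_pchar iota) pchar_Fp. Qed.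

Lemma intrK_eq0 (n : int) : (n%:~R == 0 :> K) = (2 %| n)%Z.
Proof. by rewrite -(dvdz_pcharf pcharK2). Qed.

Lemma intrK_eq (m n : int) : (2 %| m - n)%Z -> m%:~R = n%:~R :> K.
Proof. by rewrite -intrK_eq0 rmorphB subr_eq0 => /eqP. Qed.

Lemma map_poly_iota (f : {poly int}) :
  map_poly iota (map_poly intr f) = map_poly intr f.
Proof. by rewrite -map_poly_comp; apply: eq_map_poly => n /=; rewrite rmorph_int. Qed.

(** The values of [P] at the p-th roots of unity are the Fourier coefficients of [a]; characteristic
    2 absorbs the sign in [P]. *)
Lemma eval_corr_poly k :
  (map_poly intr P).[psi k] = \sum_y (a y)%:~R * psi (- (k * y)).
Proof.
rewrite rmorph_sum /= horner_sum (reindex_inj oppr_inj); apply: eq_bigr => y _.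
rewrite map_polyZ hornerZ map_polyXn hornerXn -addcharMn // natr_Fp_val mulrN opprK.
by congr (_ * _); apply: intrK_eq; lia.
Qed.

(** At a p-th root of unity in characteristic 2 both generators of the ideal vanish, so idempotency
    of [P] becomes [v ^+ 2 = v] in a field. *)
Lemma eval_corr_poly01 k :
  (map_poly intr P).[psi k] = 0 \/ (map_poly intr P).[psi k] = 1 :> K.
Proof.
set v := _.[_]; have: v * (v - 1) = 0.
  have [q [r]] := corr_poly_idem p_pr a_conv.
  move/(congr1 (fun f => (map_poly (intr : int -> K) f).[psi k])).
  rewrite rmorphB rmorphD !rmorphM /= rmorphB /= rmorph1 map_polyXn rmorph_nat.
  rewrite mulr_natl !(hornerD, hornerN, hornerM, hornerMn, hornerXn, hornerC).
  rewrite addchar_expp // subrr mulr0 add0r -/v.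
  by rewrite !(addrr_pchar2 pcharK2, addr0) mulrBr mulr1.
by move/eqP; rewrite mulf_eq0 subr_eq0 => /orP[] /eqP; [left | right].
Qed.

(** Substituting [g^-1 * y] for [y] in the second coefficient pairs [a y] with [a (g^-1 * y)]. Their
    sum is odd for [y != 0] and even for [y = 0], which leaves the sum of the character over nonzero
    [y], that is, -1 = 1. *)
Lemma eval_corr_poly_twist k : k != 0 ->
  (map_poly intr P).[psi k] + (map_poly intr P).[psi (g * k)] = 1.
Proof.
move=> nz_k; rewrite !eval_corr_poly.
rewrite [X in _ + X](reindex_inj (mulfI (invr_neq0 g_neq0))) -big_split /=.
have := sum_addchar p_pr z_prim (_ : - k != 0).
rewrite oppr_eq0 => /(_ nz_k); rewrite (bigD1 0) //= mulr0 addchar0 // => /eqP.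
rewrite addrC addr_eq0 (oppr_pchar2 pcharK2) => /eqP sum1.
rewrite (bigD1 0) //= !mulr0 -mulrDl -intrD (_ : (_ + _)%:~R = 0); last first.
  by apply/eqP; rewrite intrK_eq0; move: (a 0) => m; lia.
rewrite mul0r add0r -[RHS]sum1; apply: eq_bigr => y nz_y.
rewrite mulrACA mulfV // mul1r mulNr -mulrDl -intrD.
rewrite (_ : (_ + _)%:~R = 1) ?mul1r //; apply: (@intrK_eq _ 1).
by have := a_twist (mulf_neq0 (invr_neq0 g_neq0) nz_y); rewrite mulVKf //; lia.
Qed.

Lemma eval_corr_poly_at1 : (map_poly intr P).[psi 0] = 0.
Proof.
rewrite eval_corr_poly; under eq_bigr do rewrite mul0r oppr0 addchar0 // mulr1.
by rewrite -rmorph_sum; apply/eqP; rewrite intrK_eq0.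
Qed.

Definition freq_support : {set 'F_p} :=
  [set k | (map_poly intr P).[psi k] != 0 :> K].

Lemma freq_support0 : 0 \notin freq_support.
Proof. by rewrite inE eval_corr_poly_at1 eqxx. Qed.

Lemma freq_support_twist k :
  k != 0 -> (g * k \in freq_support) = (k \notin freq_support).
Proof.
move=> nz_k; rewrite !inE; have := eval_corr_poly_twist nz_k.
have [->|->] := eval_corr_poly01 k; first by rewrite add0r eqxx => ->; rewrite oner_eq0.
by rewrite oner_eq0 => /eqP; rewrite -subr_eq0 addrC addKr => /eqP ->; rewrite eqxx.
Qed.

(** Multiplication by [g] exchanges the support with its complement among the [p.-1] nonzero
    frequencies. *)
Lemma card_freq_support : #|freq_support| = p./2.
Proof.
set S := freq_support; pose T := [set k | k != 0] :\: S.
have eqST : #|S| = #|T|.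
  rewrite -(on_card_preimset (f := fun k => g * k)); last first.
    exists (fun k => g^-1 * k) => k _; first exact: mulKf.
    exact: mulVKf.
  apply: eq_card => k; rewrite [RHS]in_setD [X in _ && X]in_set [LHS]in_set.
  have [->|nz_k] := eqVneq k 0; first by rewrite mulr0 (negPf freq_support0) andbF.
  by rewrite freq_support_twist // andbT.
have: (#|S| + #|T| = p.-1)%N.
  have <- : #|[set k : 'F_p | k != 0]| = p.-1.
    rewrite -[in RHS](card_Fp p_pr) [in RHS](cardD1 0) inE /=.
    by apply: eq_card => k; rewrite !inE andbT.
  rewrite -[in RHS](cardsID S); congr (_ + _)%N; apply: eq_card => k.
  rewrite [RHS]in_setI [X in X && _]in_set.
  by have [->|] := eqVneq k 0; first exact: negbTE freq_support0.
rewrite -eqST; have := odd_double_half p; rewrite p_odd; lia.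
Qed.

Lemma addchar_roots_size (A : {set 'F_p}) (Q : {poly K}) : Q != 0 ->
  (forall k, k \in A -> root Q (psi k)) -> (#|A| < size Q)%N.
Proof.
move=> nzQ rtQ; rewrite -(size_image psi); apply: max_poly_roots => //.
  by apply/allP => _ /imageP[k Ak ->]; apply: rtQ.
by rewrite map_inj_uniq ?enum_uniq //; apply: addchar_inj.
Qed.

(** [G] vanishes at the frequencies of the support and [H] at all others. They are coprime divisors
    of ['X^p - 1], so the lower bounds on their degrees add up to [p] and must be attained. *)
Lemma half_annihilator_F2 : exists G : {poly 'F_2},
  [/\ G \is monic, size G = p./2.+1 & 'X^p - 1 %| G * map_poly intr P].
Proof.
set Pb := map_poly intr P; set X := 'X^p - 1 : {poly 'F_2}.
pose G := gcdp X (1 - Pb); pose H := gcdp X Pb.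
have szX : size X = p.+1 by rewrite size_XnsubC ?prime_gt0.
have nzX : X != 0 by rewrite -size_poly_eq0 szX.
have nzG : G != 0 by rewrite gcdp_eq0 (negPf nzX).
have nzH : H != 0 by rewrite gcdp_eq0 (negPf nzX).
have rootX k : root (map_poly iota X) (psi k).
  rewrite rmorphB /= map_polyXn rmorph1 /root hornerD hornerN hornerXn hornerC.
  by rewrite addchar_expp // subrr.
have szG : (#|freq_support| < size G)%N.
  rewrite -(size_map_poly iota).
  apply: addchar_roots_size => [|k]; first by rewrite map_poly_eq0.
  rewrite inE gcdp_map root_gcd rootX /=.
  rewrite rmorphB rmorph1 /= map_poly_iota /root hornerD hornerN hornerC.
  by have [->|->] := eval_corr_poly01 k; rewrite ?eqxx ?subrr.
have szH : (#|~: freq_support| < size H)%N.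
  rewrite -(size_map_poly iota).
  apply: addchar_roots_size => [|k]; first by rewrite map_poly_eq0.
  rewrite !inE negbK gcdp_map root_gcd rootX /=.
  by rewrite map_poly_iota.
have coGH : coprimep G H.
  apply: coprimep_dvdl (dvdp_gcdr _ _) _; apply: coprimep_dvdr (dvdp_gcdr _ _) _.
  by apply/Bezout_coprimepP; exists (1, 1); rewrite !mul1r subrK eqpxx.
have: (size (G * H)%R <= p.+1)%N.
  by rewrite -szX dvdp_leq // Gauss_dvdp // !dvdp_gcdl.
rewrite size_mul // => leGH; exists G; split; first exact: monic_F2.
  move: (cardsC freq_support); rewrite card_Fp // => cS.
  move: szG szH cS leGH; rewrite card_freq_support; have := odd_double_half p.
  by rewrite p_odd; move: (size G) (size H) #|~: _| => sG sH c; lia.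
(* By Bezout [G] is, up to a unit, a combination of ['X^p - 1] and [1 - Pb], and idempotency makes
   [(1 - Pb) * Pb] a multiple of ['X^p - 1]. *)
have [u /(eqp_mulr Pb)/eqp_dvdr <-] := Bezoutp X (1 - Pb).
have [q [r /(congr1 (fun f => map_poly (intr : int -> 'F_2) f))]] := corr_poly_idem p_pr a_conv.
rewrite rmorphB rmorphD !rmorphM /= rmorphB /= rmorph1 map_polyXn -/Pb rmorph_nat.
have -> : 4%:R = 0 :> {poly 'F_2}.
  by rewrite -[4%N]/(2 * 2)%N natrM -polyC1 -polyCMn (pcharf0 (pchar_Fp _)) ?mul0r.
rewrite mul0r addr0 => PbE.
rewrite mulrDl dvdp_addr; last by rewrite mulrAC dvdp_mull.
by rewrite -mulrA mulrBl mul1r -opprB PbE mulrN dvdpNr mulrA dvdp_mull.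
Qed.

(* Hensel lifting: if f * P = 2 * x modulo X ^ p - 1 with f monic, then
   idempotency of P lets x be reduced modulo f, and f - 2 * (x mod f) works
   modulo 4. *)
Lemma half_annihilator : exists M : {poly int},
  [/\ M \is monic, size M = p./2.+1 & cyclic4 p (M * P)].
Proof.
have [G [monG szG /dvdpP[qb GP]]] := half_annihilator_F2.
pose f := lift_poly G; pose q := lift_poly qb.
have [x fP] : exists x, f * P - q * ('X^p - 1) = 2%:R * x.
  apply: map_poly_F2_eq0.
  rewrite rmorphB !rmorphM /= rmorphB /= map_polyXn rmorph1 !map_lift_poly GP.
  by rewrite subrr.
have mon_f : f \is monic by apply: lift_poly_monic.
have szf : size f = p./2.+1 by rewrite size_lift_poly.
have x_eq := Pdiv.RingMonic.rdivp_eq mon_f x.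
set k := Pdiv.Ring.rdivp x f in x_eq; set r := Pdiv.Ring.rmodp x f in x_eq.
have lt_r : (size (2%:R * r)%R < size f)%N.
  rewrite mulr_natl -scaler_nat (leq_ltn_trans (size_scale_leq _ _)) //.
  by rewrite Pdiv.Ring.ltn_rmodp monic_neq0.
exists (f - 2%:R * r); split.
- by rewrite monicE lead_coefDl ?size_polyN // -monicE.
- by rewrite size_polyDl ?size_polyN.
have [q' [y PP]] := corr_poly_idem p_pr a_conv.
exists (q * P + 2%:R * k * q - f * q'), (k * x - f * y).
have -> : r = x - k * f by rewrite x_eq addrC addKr.
(* Writing [f * P] as [f * P * P - f * (P * P - P)] creates a term [2 * x * P] that cancels the one
   from [2 * r * P]; what remains is visibly in the ideal. *)
transitivity ((f * P) * P - f * (P * P - P) - 2%:R * x * P + 2%:R * k * (f * P)).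
  by ring.
have -> : f * P = 2%:R * x + q * ('X^p - 1) by rewrite -fP subrK.
by rewrite PP; ring.
Qed.

(** A shift multiplies the Fourier coefficient at [k] by [psi k], hence [f] multiplies it by the
    value of [f] at [psi k]. That product is zero in characteristic 2 when [f] annihilates [s]
    modulo 2. *)
Lemma freq_support_root (s : 'F_p -> int) (f : {poly int}) k :
  (forall u, (2 %| shift_act f (fun v => s v%:R) u)%Z) ->
  \sum_y (s y)%:~R * psi (- (k * y)) != 0 ->
  root (map_poly intr f) (psi k).
Proof.
move=> f_s nz_sk; apply/rootP/(mulIf nz_sk); rewrite mul0r.
transitivity (\sum_(y : 'F_p) psi (- (k * y)) *
   (shift_act f (fun v => s v%:R) (nat_of_ord y))%:~R : K); last first.
  rewrite big1 // => y _; have := f_s (nat_of_ord y).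
  by rewrite -intrK_eq0 => /eqP->; rewrite mulr0.
under [RHS]eq_bigr => y _ do rewrite rmorph_sum mulr_sumr.
rewrite exchange_big (horner_coef_wide _ (size_poly _ _)) mulr_suml /=.
apply: eq_bigr => i _; rewrite coef_map mulr_sumr [RHS](reindex_inj (addIr (- i%:R))).
apply: eq_bigr => y _; rewrite natrD natr_Fp_val subrK intrM.
rewrite mulrBr opprB addcharD // addcharMn //; ring.
Qed.

(** A constant contributes only to the trivial frequency, which lies outside the support. *)
Lemma freq_support_roots (f : {poly int}) c :
  (forall u, (2 %| shift_act f (fun v => a v%:R + c) u)%Z) ->
  forall k, k \in freq_support -> root (map_poly intr f) (psi k).
Proof.
move=> f_ac k Sk; apply: (@freq_support_root (fun y => a y + c)) => //.
have nz_k : k != 0 by apply: contraTneq Sk => ->; exact: freq_support0.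
under eq_bigr do rewrite intrD mulrDl.
rewrite big_split -mulr_sumr /=; under [X in _ * X]eq_bigr do rewrite -mulNr.
rewrite sum_addchar ?oppr_eq0 // mulr0 addr0 -eval_corr_poly.
by rewrite inE in Sk.
Qed.

(** The trivial Fourier coefficient of [a + c] is an even sum plus [p * c], hence odd, so 1 is a
    root besides those of the support. *)
Lemma annihilator_size_odd (f : {poly int}) c : f \is monic -> ~~ (2 %| c)%Z ->
  (forall u, (2 %| shift_act f (fun v => a v%:R + c) u)%Z) ->
  (p./2.+1 < size f)%N.
Proof.
move=> mon_f c_odd f_ac; rewrite -card_freq_support.
have -> : #|freq_support|.+1 = #|(0 : 'F_p) |: freq_support|.
  by rewrite cardsU1 freq_support0.
rewrite -(size_map_poly_id0 (f := intr : int -> K)); last first.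
  by rewrite (monicP mon_f) oner_eq0.
apply: addchar_roots_size => [|k]; first by apply/monic_neq0/monic_map.
case/setU1P => [->|]; last exact: freq_support_roots f_ac k.
apply: (@freq_support_root (fun y => a y + c)) => //.
under eq_bigr do rewrite mul0r oppr0 addchar0 // mulr1.
rewrite -rmorph_sum intrK_eq0 big_split sumr_const card_Fp // -mulr_natr natz /=.
have := odd_double_half p; rewrite p_odd; move: (\sum_y _) a_sum => A; lia.
Qed.

(** Annihilating the parity sequence forces the remainder of [f] by ['X^2 - 1] to be even: times 1
    and 0 read off its two coefficients. In characteristic 2, ['X^2 - 1] is the square of ['X - 1],
    so the roots at the support belong to the quotient. *)
Lemma annihilator_size_double (f : {poly int}) : f \is monic ->
  (forall u, (2 %| shift_act f (fun v => a v%:R) u)%Z) ->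
  (forall u, (2 %| shift_act f (fun v => (odd v)%:Z) u)%Z) ->
  (p./2.+2 < size f)%N.
Proof.
move=> mon_f f_a f_odd.
have mon2 : ('X^2 - 1 : {poly int}) \is monic by rewrite monicXnsubC.
have f_eq := Pdiv.RingMonic.rdivp_eq mon2 f.
set q := Pdiv.Ring.rdivp f _ in f_eq; set r := Pdiv.Ring.rmodp f _ in f_eq.
have sz_r : (size r <= 2)%N.
  have := Pdiv.Ring.ltn_rmodp f ('X^2 - 1).
  by rewrite monic_neq0 // size_XnsubC.
have r_odd u : (2 %| r`_0 * (odd u)%:Z + r`_1 * (odd u.+1)%:Z)%Z.
  have := f_odd u; rewrite f_eq shift_actD shift_actM rpredDl; last first.
    apply: shift_act_dvd => v; rewrite -scaleN1r shift_actD shift_actZ shift_act1.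
    by rewrite shift_actXn oddD addbF mulN1r subrr.
  by rewrite (shift_act_wide _ _ sz_r) big_ord_recl big_ord1 addn0 addn1.
pose fK := map_poly intr f : {poly K}; pose qK := map_poly intr q : {poly K}.
have fKE : fK = qK * ('X^2 - 1).
  rewrite /fK f_eq rmorphD rmorphM /= rmorphB /= map_polyXn rmorph1.
  suff -> : map_poly intr r = 0 :> {poly K} by rewrite addr0.
  apply/polyP => i; rewrite coef_map coef0; apply/eqP; rewrite intrK_eq0.
  case: i => [|[|i]]; last by rewrite nth_default // (leq_trans sz_r).
    by have := r_odd 1%N; rewrite mulr1 mulr0 addr0.
  by have := r_odd 0%N; rewrite mulr1 mulr0 add0r.
have nz_fK : fK != 0 by apply/monic_neq0/monic_map.
have nz_qK : qK != 0 by apply: contraNneq nz_fK => q0; rewrite fKE q0 mul0r.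
have -> : size f = size fK.
  by rewrite size_map_poly_id0 // (monicP mon_f) oner_eq0.
rewrite fKE size_Mmonic ?monicXnsubC // size_XnsubC // addn3 /= !ltnS.
rewrite -card_freq_support; apply: addchar_roots_size => // k Sk.
have: root fK (psi k).
  apply: (@freq_support_roots f 0) => // u.
  by rewrite (@eq_shift_act _ f _ (fun v => a v%:R)) // => v; rewrite addr0.
rewrite fKE rootM; case/orP => //.
rewrite /root hornerD hornerN hornerXn hornerC subr_sqr_1 mulf_eq0.
have -> : psi k + 1 = psi k - 1 by rewrite (oppr_pchar2 pcharK2).
rewrite orbb subr_eq0 -(addchar0 p_pr z_prim).
by move/eqP/(addchar_inj p_pr z_prim) => k0; rewrite k0 (negPf freq_support0) in Sk.
Qed.

End Core.

(** * Recurrences and values of the sequence *)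

Lemma intr_Zp_eq0 (m : nat) (n : int) : (1 < m)%N ->
  (n%:~R == 0 :> 'Z_m) = (m %| n)%Z.
Proof.
move=> m_gt1; have natE k : (k%:R == 0 :> 'Z_m) = (m %| k)%N.
  by rewrite -val_eqE /= val_Zp_nat.
case: n => k; first exact: natE.
by rewrite NegzE rmorphN oppr_eq0 rpredN; exact: natE.
Qed.

Lemma intr_Zp_eq (m : nat) (x y : int) : (1 < m)%N ->
  (x%:~R == y%:~R :> 'Z_m) = (m %| x - y)%Z.
Proof. by move=> m_gt1; rewrite -subr_eq0 -rmorphB intr_Zp_eq0. Qed.

(** The coefficient of index [j < L] is a lift of [c (L - j)]. Working over the integers allows the
    same polynomial to be reduced modulo 4 and modulo 2. *)
Lemma linear_recurrence_polyP (m : nat) (sm : nat -> 'Z_m) (s : nat -> int) L :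
  (1 < m)%N -> (forall u, sm u = (s u)%:~R) ->
  has_linear_recurrence sm L <->
  exists f : {poly int}, [/\ f \is monic, size f = L.+1 &
    forall u, (m %| shift_act f s u)%Z].
Proof.
move=> m_gt1 smE.
have recE (c : nat -> 'Z_m) (f : {poly int}) u :
    f \is monic -> size f = L.+1 -> (forall j, (j < L)%N -> c (L - j)%N = (f`_j)%:~R) ->
  sm (u + L)%N + \sum_(1 <= i < L.+1) c i * sm (u + L - i)%N =
  (shift_act f s u)%:~R.
  move=> mon_f sz_f cE; rewrite /shift_act sz_f big_ord_recr /= rmorphD addrC.
  have -> : f`_L = 1 by move/monicP: mon_f; rewrite lead_coefE sz_f.
  rewrite mul1r smE; congr (_ + _); rewrite big_add1 big_mkord rmorph_sum /=.
  rewrite (reindex_inj rev_ord_inj) /=; apply: eq_bigr => j _.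
  have lt_jL := ltn_ord j; rewrite subnSK // cE // intrM smE.
  by rewrite (_ : u + L - (L - j) = u + j)%N //; lia.
split=> [[c rec_c] | [f [mon_f sz_f f_s]]].
  pose r : {poly int} := \poly_(j < L) (nat_of_ord (c (L - j)%N))%:Z.
  have lt_r : (size r < size ('X^L : {poly int}))%N.
    by rewrite size_polyXn ltnS size_poly.
  have mon_f : 'X^L + r \is monic by rewrite monicE lead_coefDl // lead_coefXn.
  have sz_f : size ('X^L + r) = L.+1 by rewrite size_polyDl // size_polyXn.
  exists ('X^L + r); split=> // u; rewrite -intr_Zp_eq0 // -(recE c) ?rec_c // => j lt_jL.
  by rewrite coefD coefXn coef_poly lt_jL ltn_eqF // add0r -pmulrn natr_Zp.
exists (fun i => (f`_(L - i))%:~R) => u.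
rewrite (recE _ f) // => [|j lt_jL]; last by rewrite subKn // ltnW.
by apply/eqP; rewrite intr_Zp_eq0.
Qed.

Lemma shift_act_dvd_congr (m : int) (f : {poly int}) (s t : nat -> int) u :
  (forall v, (m %| s v - t v)%Z) ->
  (m %| shift_act f s u)%Z = (m %| shift_act f t u)%Z.
Proof.
move=> dv_st; have -> : shift_act f s u =
    shift_act f (fun v => s v - t v) u + shift_act f t u.
  by rewrite -shift_act_addr; apply: eq_shift_act => v; rewrite subrK.
by rewrite rpredDl // shift_act_dvd.
Qed.

(** A closed form of the sequence modulo 4 when 2 is a square modulo [p]. At multiples of [2 * p] it
    takes the value 4, standing for 0. *)
Definition quaternary_lift (p u : nat) : int :=
  let y : 'F_p := u%:R in
  (qchar y == -1)%:Z + 2 * (y == 0)%:Z + 2 * (~~ odd u)%:Z.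

(** * The sequence through parity and the quadratic character *)

Section SequenceValues.
Variables (p : nat) (g : int).
Hypotheses (p_pr : prime p) (p_odd : odd p).
Hypothesis g_prim : primitive_root_mod p g.
Local Notation gF := (g%:~R : 'F_p).

Lemma primitive_root_Fp : p.-1.-primitive_root gF.
Proof.
rewrite -(totient_prime p_pr); move: g_prim; rewrite /primitive_root_mod.
(* ['F_p] is ['Z_(pdiv p)], so generalizing [pdiv p] identifies it with ['Z_p]. *)
have : pdiv p = p by exact: pdiv_id.
by move: (pdiv p) => q ->.
Qed.

Lemma qcharX (y : 'F_p) n : qchar (y ^+ n) = qchar y ^+ n.
Proof.
elim: n => [|n IHn]; first by rewrite !expr0 qchar1.
by rewrite !exprS qcharM // IHn.
Qed.

Lemma qchar_primitive_root : qchar gF = -1.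
Proof.
have p2 : p.-1 = p./2.*2 by have := odd_double_half p; rewrite p_odd; lia.
have p_gt2 := odd_prime_gt2 p_odd p_pr.
have nz_g : gF != 0.
  apply: contra_eq_neq (prim_expr_order primitive_root_Fp) => ->.
  by rewrite expr0n eq_sym (_ : p.-1 == 0%N = false) ?oner_neq0 //; lia.
rewrite /qchar (negPf nz_g) -(prim_order_dvd primitive_root_Fp) gtnNdvd //; lia.
Qed.

(** A nonzero [y] is [gF ^+ j] with [j < p.-1], and its character reads off the parity of [j]
    because [gF] is a nonresidue; [j./2] is then an admissible index. *)
Lemma Fp_class_powers (y : 'F_p) (i : bool) :
  reflect (exists n : 'I_((p - 3)./2.+1), y = gF ^+ (2 * n + i))
          (qchar y == (-1) ^+ i).
Proof.
have p_gt2 := odd_prime_gt2 p_odd p_pr.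
have p2 := odd_double_half p; rewrite p_odd in p2.
apply: (iffP eqP) => [qy|[n ->]]; last first.
  rewrite qcharX qchar_primitive_root exprD exprM sqrrN !expr1n mul1r //.
have nz_y : y != 0.
  by apply: contra_eq_neq qy => ->; rewrite qchar0; case: i.
have yp1 : y ^+ p.-1 = 1.
  have -> : p.-1 = (p./2 * 2)%N by lia.
  by rewrite exprM; have [->|->] := Fp_expf_half p_pr p_odd nz_y; rewrite ?sqrrN expr1n.
have [j yj] := prim_rootP primitive_root_Fp yp1.
have j_odd : odd j = i.
  move: qy; rewrite yj qcharX qchar_primitive_root -[X in X = _ -> _]signr_odd.
  exact: Num.Theory.signr_inj.
have lt_j2 : (j./2 < (p - 3)./2.+1)%N by have := ltn_ord j; lia.
exists (Ordinal lt_j2); rewrite yj; congr (_ ^+ _) => /=.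
by have := odd_double_half j; rewrite j_odd; lia.
Qed.

(** Chinese remaindering for the coprime moduli 2 and [p]. *)
Lemma Z2p_eq (u : nat) (v : int) :
  (u%:R == v%:~R :> 'Z_(2 * p)) =
  (2 %| u%:Z - v)%Z && (u%:R == v%:~R :> 'F_p).
Proof.
have p_gt2 := odd_prime_gt2 p_odd p_pr.
rewrite [u%:R in LHS]pmulrn intr_Zp_eq; last by lia.
rewrite [u%:R]pmulrn -subr_eq0 -rmorphB -(dvdz_pcharf (pchar_Fp p_pr)).
by rewrite PoszM Gauss_dvdz // coprimezE coprime2n.
Qed.

Hypothesis g_odd : ~~ (2 %| g)%Z.

Lemma mem_classD (u : nat) (i : bool) :
  (u%:R \in classD p g i) = odd u && (qchar (u%:R : 'F_p) == (-1) ^+ i).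
Proof.
have Dparity n : (2 %| u%:Z - g ^+ n)%Z = odd u.
  have : ~~ (2 %| g ^+ n)%Z.
    by rewrite dvdzE abszX Euclid_dvdX // negb_and -dvdzE g_odd.
  lia.
apply/imsetP/andP => [[n _ /eqP]|[u_odd /Fp_class_powers[n yE]]].
  rewrite -rmorphXn Z2p_eq Dparity rmorphXn => /andP[u_odd /eqP yE].
  by split=> //; apply/Fp_class_powers; exists n.
exists n => //; apply/eqP.
by rewrite -rmorphXn Z2p_eq Dparity u_odd rmorphXn yE eqxx.
Qed.

(** Doubling makes elements even and, 2 being a square modulo [p], preserves the quadratic
    character. *)
Lemma mem_classE (u : nat) (i : bool) : qchar (2%:R : 'F_p) = 1 ->
  (u%:R \in classE p g i) = ~~ odd u && (qchar (u%:R : 'F_p) == (-1) ^+ i).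
Proof.
move=> q2.
have nz2 : 2%:R != 0 :> 'F_p by apply: contra_eq_neq q2 => ->; rewrite qchar0.
have -> : qchar (u%:R : 'F_p) = qchar (u%:R / 2%:R : 'F_p).
  by rewrite qcharM // qcharV // q2 mulr1.
have Dparity (n : int) : (2 %| u%:Z - 2 * n)%Z = ~~ odd u by lia.
have zE n : 2%:R * (g%:~R : 'Z_(2 * p)) ^+ n = (2 * g ^+ n)%:~R.
  by rewrite intrM rmorphXn.
apply/imsetP/andP => [[_ /imsetP[n _ ->] /eqP]|[u_odd /Fp_class_powers[n yE]]].
  rewrite zE Z2p_eq Dparity => /andP[u_odd /eqP yE].
  split=> //; apply/Fp_class_powers; exists n.
  by rewrite yE rmorphM /= mulrC mulKf // rmorphXn.
exists ((g%:~R : 'Z_(2 * p)) ^+ (2 * n + i)); first by apply/imsetP; exists n.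
apply/eqP; rewrite zE Z2p_eq Dparity u_odd.
by rewrite rmorphM rmorphXn /= -yE mulrC divfK.
Qed.

Lemma quaternary_seqE (u : nat) : qchar (2%:R : 'F_p) = 1 ->
  quaternary_seq p g u = (quaternary_lift p u)%:~R.
Proof.
move=> q2; rewrite /quaternary_seq /quaternary_lift; set y : 'F_p := u%:R.
rewrite (mem_classD u false) (mem_classD u true).
rewrite (mem_classE u false q2) (mem_classE u true q2) -/y.
have -> : (u%:R == 0 :> 'Z_(2 * p)) = ~~ odd u && (y == 0).
  rewrite (Z2p_eq u 0) subr0; congr (_ && _); lia.
have -> : (u%:R == p%:R :> 'Z_(2 * p)) = odd u && (y == 0).
  rewrite [p%:R in LHS]pmulrn (Z2p_eq u p) -pmulrn (pcharf0 (pchar_Fp p_pr)).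
  congr (_ && _); lia.
have [->|nz_y] := eqVneq y 0; first by rewrite qchar0; case: (odd u); apply/eqP.
by have [->|->] := qchar_cases nz_y; case: (odd u); apply/eqP.
Qed.

End SequenceValues.

(** * The periodic component *)

Section ResidueClassFunction.
Variable p : nat.
Hypotheses (p_pr : prime p) (p_odd : odd p).

Definition residue_fun (c0 c1 : int) (y : 'F_p) : int :=
  if y == 0 then c0 else if qchar y == -1 then c1 + 1 else c1.

Variables c0 c1 : int.
Local Notation a := (residue_fun c0 c1).
Local Notation A := (2 * c1 + 1).
Local Notation B := (2 * c0 - 2 * c1 - 1).

(** Off zero the function is [c1] plus half of [1 - qchar y]; doubling avoids the fraction, and [B]
    corrects the value at 0. *)
Lemma double_residue_fun y : 2 * a y = A + B * (y == 0)%:R - qchar y.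
Proof.
rewrite /residue_fun; have [->|nz_y] := eqVneq y 0; first by rewrite qchar0 /=; lia.
by have [->|->] := qchar_cases nz_y; rewrite /= mulr0; lia.
Qed.

Variable g : 'F_p.
Hypothesis g_nonres : qchar g = -1.

Lemma residue_fun_twist y : y != 0 -> a y + a (g * y) = A.
Proof.
move=> nz_y; rewrite /residue_fun mulf_eq0 (negPf nz_y) (negPf (nonres_neq0 g_nonres)).
rewrite qcharM // g_nonres mulN1r eqr_opp.
by have [->|->] := qchar_cases nz_y; rewrite /=; lia.
Qed.

Lemma sum_Fp_delta (F : 'F_p -> int) (x : 'F_p) :
  \sum_y F y * (y == x)%:R = F x.
Proof.
rewrite (bigD1 x) //= eqxx mulr1 big1 ?addr0 // => y /negPf->.
by rewrite mulr0.
Qed.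

Lemma double_sum_residue_fun : 2 * (\sum_y a y) = A * p%:Z + B.
Proof.
rewrite mulr_sumr; under eq_bigr do rewrite double_residue_fun.
rewrite sumrB (sum_qchar _ _ g_nonres) // subr0 big_split /=.
rewrite (sum_Fp_delta (fun=> B)) -(sum_Fp1 p_pr) mulr_sumr.
by under [in RHS]eq_bigr do rewrite mulr1.
Qed.

(** Bilinear expansion in the constant, the delta at 0 and the character, with the factor 4 coming
    from the two doublings. Only the convolution of the character with itself needs the Jacobi
    sum. *)
Lemma conv_residue_fun w :
  4 * (\sum_y a y * a (w - y)) = A ^+ 2 * p%:Z + 2 * A * B + B ^+ 2 * (w == 0)%:R
    - 2 * B * qchar w + qchar (-1 : 'F_p) * (p%:Z * (w == 0)%:R - 1).
Proof.
have refl_inj : injective (fun y : 'F_p => w - y) by move=> x y /addrI/oppr_inj.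
have sumE (F : 'F_p -> int) : \sum_y F (w - y) = \sum_y F y.
  by rewrite [RHS](reindex_inj refl_inj).
have deltaE (y : 'F_p) : (w - y == 0) = (y == w) by rewrite subr_eq0 eq_sym.
rewrite -(jacobi_sum p_pr p_odd g_nonres).
transitivity (\sum_y (A * (A * 1 - qchar y - qchar (w - y))
   + (A * B) * ((y == 0)%:R + (w - y == 0)%:R)
   + (B ^+ 2 * (w - y == 0)%:R - B * qchar (w - y)) * (y == 0)%:R
   - (B * qchar y) * (y == w)%:R + qchar y * qchar (w - y))).
  rewrite mulr_sumr; apply: eq_bigr => y _.
  have -> : 4 * (a y * a (w - y)) = (2 * a y) * (2 * a (w - y)) by ring.
  by rewrite !double_residue_fun deltaE; ring.
rewrite !(big_split, sumrN, sumrB) /= !sum_Fp_delta -!mulr_sumr.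
have -> : \sum_y (A * 1 - qchar y - qchar (w - y)) = A * p%:Z.
  by rewrite !sumrB -mulr_sumr sum_Fp1 // sumE (sum_qchar _ _ g_nonres) // !subr0.
have -> : \sum_y ((y == 0)%:R + (w - y == 0)%:R) = 2 :> int.
  rewrite big_split /= (sumE (fun y => (y == 0)%:R)).
  have -> : \sum_(y : 'F_p) (y == 0)%:R = 1 :> int.
    by rewrite -[RHS](sum_Fp_delta (fun=> 1) 0); apply: eq_bigr => y _; rewrite mul1r.
  by [].
by rewrite subr0; ring.
Qed.

End ResidueClassFunction.

(* The constants of this lemma and the next one make residue_fun equal modulo 4
   to the sequence minus its component of period 2. *)
Lemma residue_fun_conv9 p (g : 'F_p) : prime p -> odd p -> qchar g = -1 ->
  (p %% 16 = 9)%N -> forall w : 'F_p,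
  (4 %| \sum_y residue_fun 0 2 y * residue_fun 0 2 (w - y) + residue_fun 0 2 w)%Z.
Proof.
move=> p_pr p_odd g_nonres p9 w.
have := @conv_residue_fun p p_pr p_odd 0 2 g g_nonres w.
have := @double_residue_fun p p_pr p_odd 0 2 w.
move: (\sum_y _) (residue_fun _ _ _) => S aw.
have -> : qchar (-1 : 'F_p) = 1.
  by rewrite qcharN1 // -signr_odd (_ : odd p./2 = false) //; lia.
(* Four times the claim is a congruence modulo 16 that is linear in [p]; this is where the residue
   of [p] modulo 16 enters. *)
have [->|nz_w] := eqVneq w 0; first by rewrite qchar0 /= !expr2; lia.
by have [->|->] := qchar_cases nz_w; rewrite /= !expr2 !mulr0; lia.
Qed.

Lemma residue_fun_conv7 p (g : 'F_p) : prime p -> odd p -> qchar g = -1 ->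
  (p %% 16 = 7)%N -> forall w : 'F_p,
  (4 %| \sum_y residue_fun 3 1 y * residue_fun 3 1 (w - y) + residue_fun 3 1 w)%Z.
Proof.
move=> p_pr p_odd g_nonres p7 w.
have := @conv_residue_fun p p_pr p_odd 3 1 g g_nonres w.
have := @double_residue_fun p p_pr p_odd 3 1 w.
move: (\sum_y _) (residue_fun _ _ _) => S aw.
have -> : qchar (-1 : 'F_p) = -1.
  by rewrite qcharN1 // -signr_odd (_ : odd p./2 = true) //; lia.
have [->|nz_w] := eqVneq w 0; first by rewrite qchar0 /= !expr2; lia.
by have [->|->] := qchar_cases nz_w; rewrite /= !expr2 !mulr0; lia.
Qed.


(** * Linear complexity in the two residue classes modulo 16 *)

Lemma char2_primitive_root (p : nat) : prime p -> odd p ->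
  exists (K : closedFieldType) (iota : {rmorphism 'F_2 -> K}) (z : K),
    p.-primitive_root z.
Proof.
move=> p_pr p_odd; have [K [iota _]] := countable_algebraic_closure 'F_2.
have [|z z_prim] := @prime_primitive_root p K p_pr; last by exists K, iota, z.
rewrite -(dvdn_pcharf (pcharK2 iota)) dvdn2 negbK //.
Qed.

Lemma qchar2 (p : nat) : prime p -> odd p ->
  (p %% 8 == 1)%N || (p %% 8 == 7)%N -> qchar (2%:R : 'F_p) = 1.
Proof.
move=> p_pr p_odd p8; rewrite /qchar two_quadratic_residue // eqxx.
rewrite -(dvdn_pcharf (pchar_Fp p_pr)) dvdn_prime2 //.
by case: eqP => // p2; rewrite p2 in p_odd.
Qed.

Section LinearComplexity.
Variables (p : nat) (g : int).
Hypotheses (p_pr : prime p) (p_odd : odd p) (g_odd : ~~ (2 %| g)%Z).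
Hypothesis g_prim : primitive_root_mod p g.

(** The component of period 2 is twice the parity sequence, so an annihilator modulo 4 must kill the
    parity sequence modulo 2; this costs a double root at 1. *)
Lemma linear_complexity_9 : (p %% 16 = 9)%N ->
  is_linear_complexity (quaternary_seq p g) (p./2.+2).
Proof.
move=> p9; pose a := @residue_fun p 0 2.
have g_nonres := qchar_primitive_root p_pr p_odd g_prim.
have q2 : qchar (2%:R : 'F_p) = 1 by apply: qchar2 => //; lia.
have [K [iota [z z_prim]]] := char2_primitive_root p_pr p_odd.
have a_conv := residue_fun_conv9 p_pr p_odd g_nonres p9.
have a_twist y (nz_y : y != 0) : (2 %| a y + a (g%:~R * y) - 1)%Z.
  by rewrite (residue_fun_twist p_pr p_odd _ _ g_nonres nz_y); lia.
(* Divisibility by 4, not just by 2, is needed to discard the constant when averaging over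
   shifts. *)
have a_sum : (4 %| \sum_y a y)%Z.
  have := double_sum_residue_fun p_pr p_odd 0 2 g_nonres.
  by rewrite -/a; move: (\sum_y _) => S; lia.
have a_sum2 : (2 %| \sum_y a y)%Z by exact: dvdz_trans a_sum.
have nz_g := nonres_neq0 g_nonres.
pose t u : int := a u%:R + 2 * (odd u)%:Z.
have sE u := quaternary_seqE p_pr p_odd g_prim g_odd u q2.
have s_t u : (4 %| quaternary_lift p u - t u)%Z.
  rewrite /quaternary_lift /t /a /residue_fun; move: (u%:R : 'F_p) => y.
  have [->|nz_y] := eqVneq y 0; first by rewrite qchar0; case: (odd u).
  by have [->|->] := qchar_cases nz_y; case: (odd u).
split=> [|L /(linear_recurrence_polyP L (isT : 1 < 4)%N sE) [f [mon_f sz_f f_s]]].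
  apply/(linear_recurrence_polyP _ (isT : 1 < 4)%N sE).
  have [M [mon_M sz_M MP]] :=
    half_annihilator iota p_pr p_odd z_prim a_conv a_twist a_sum2 nz_g.
  have M_a := cyclic4_annihil p_pr MP.
  have mon2 : ('X^2 - 1 : {poly int}) \is monic by rewrite monicXnsubC.
  exists (M * ('X^2 - 1)); split; first by rewrite monicMr.
    by rewrite size_Mmonic ?monic_neq0 // size_XnsubC // sz_M addn3.
  move=> u; rewrite (shift_act_dvd_congr _ _ s_t) shift_act_addr rpredD //.
    by rewrite mulrC shift_actM; apply: shift_act_dvd.
  rewrite shift_actM; apply: shift_act_dvd => v; rewrite -scaleN1r shift_actD.
  by rewrite shift_actZ shift_act1 shift_actXn oddD addbF mulN1r subrr.
have f_t u : (4 %| shift_act f t u)%Z by rewrite -(shift_act_dvd_congr _ _ s_t).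
(* Summing over the shifts by 2 y, y mod p, leaves only the parity component. *)
have f_odd u : (2 %| shift_act f (fun v => (odd v)%:Z) u)%Z.
  (* As 2 is invertible modulo [p], [v + 2 * y] meets each class modulo [p] once and keeps the
     parity of [v]. *)
  have t_sum v : \sum_(y : 'F_p) t (v + 2 * (y : nat))%N
      = \sum_y a y + 2 * p%:Z * (odd v)%:Z.
    rewrite big_split /=; congr (_ + _).
      have nz2 : 2%:R != 0 :> 'F_p by apply: contra_eq_neq q2 => ->; rewrite qchar0.
      rewrite [RHS](reindex_inj (mulfI nz2)) [RHS](reindex_inj (addrI (v%:R / 2%:R))).
      apply: eq_bigr => y _; congr a; rewrite natrD natrM natr_Fp_val.
      by rewrite mulrDr [2%:R * (_ / _)]mulrCA divff // mulr1.
    under eq_bigr do rewrite oddD mul2n odd_double addbF.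
    by rewrite sumr_const card_Fp // -mulr_natr natz; ring.
  have: (4 %| \sum_(y : 'F_p) shift_act f t (u + 2 * (y : nat))%N)%Z.
    by apply: rpred_sum.
  have -> : \sum_(y : 'F_p) shift_act f t (u + 2 * (y : nat))%N =
     shift_act f (fun v => \sum_y a y + 2 * p%:Z * (odd v)%:Z) u.
    rewrite exchange_big; apply: eq_bigr => i _ /=; rewrite -mulr_sumr -t_sum.
    by under eq_bigr do rewrite addnAC.
  rewrite shift_act_addr rpredDl; last exact: shift_act_dvd.
  rewrite shift_act_mulr; move: (shift_act _ _ _) => S.
  (* What is known is that 4 divides [2 * p * S]; as [p] is odd, [S] is even. *)
  rewrite -[(2 %| S)%Z](@Gauss_dvdzr 2 p%:Z) ?coprimezE ?coprime2n //.
  by rewrite -mulrA; move: (p%:Z * S) => T /dvdzP[c]; lia.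
have f_a u : (2 %| shift_act f (fun v => a v%:R) u)%Z.
  rewrite -(@shift_act_dvd_congr _ _ t) => [|v]; last by rewrite /t; lia.
  by apply: dvdz_trans (f_t u).
have := annihilator_size_double iota p_pr p_odd z_prim a_conv a_twist a_sum2 nz_g
  mon_f f_a f_odd.
by rewrite sz_f.
Qed.

(** The component of period 2 is now congruent to the constant 1 modulo 2, which costs only a simple
    root at 1. *)
Lemma linear_complexity_7 : (p %% 16 = 7)%N ->
  is_linear_complexity (quaternary_seq p g) (p./2.+1).
Proof.
move=> p7; pose a := @residue_fun p 3 1.
have g_nonres := qchar_primitive_root p_pr p_odd g_prim.
have q2 : qchar (2%:R : 'F_p) = 1 by apply: qchar2 => //; lia.
have [K [iota [z z_prim]]] := char2_primitive_root p_pr p_odd.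
have a_conv := residue_fun_conv7 p_pr p_odd g_nonres p7.
have a_twist y (nz_y : y != 0) : (2 %| a y + a (g%:~R * y) - 1)%Z.
  by rewrite (residue_fun_twist p_pr p_odd _ _ g_nonres nz_y); lia.
have a_sum : (2 %| \sum_y a y)%Z.
  have := double_sum_residue_fun p_pr p_odd 3 1 g_nonres.
  by rewrite -/a; move: (\sum_y _) => S; lia.
have nz_g := nonres_neq0 g_nonres.
(* The second summand is the alternating sign, killed by ['X + 1]. *)
pose t u : int := a u%:R + (1 - 2 * (odd u)%:Z).
have sE u := quaternary_seqE p_pr p_odd g_prim g_odd u q2.
have s_t u : (4 %| quaternary_lift p u - t u)%Z.
  rewrite /quaternary_lift /t /a /residue_fun; move: (u%:R : 'F_p) => y.
  have [->|nz_y] := eqVneq y 0; first by rewrite qchar0; case: (odd u).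
  by have [->|->] := qchar_cases nz_y; case: (odd u).
split=> [|L /(linear_recurrence_polyP L (isT : 1 < 4)%N sE) [f [mon_f sz_f f_s]]].
  apply/(linear_recurrence_polyP _ (isT : 1 < 4)%N sE).
  have [M [mon_M sz_M MP]] :=
    half_annihilator iota p_pr p_odd z_prim a_conv a_twist a_sum nz_g.
  have M_a := cyclic4_annihil p_pr MP.
  have mon1 : ('X + 1 : {poly int}) \is monic by rewrite -polyC1 monicXaddC.
  exists (M * ('X + 1)); split; first by rewrite monicMr.
    by rewrite size_Mmonic ?monic_neq0 // -polyC1 size_XaddC sz_M addn2.
  move=> u; rewrite (shift_act_dvd_congr _ _ s_t) shift_act_addr rpredD //.
    by rewrite mulrC shift_actM; apply: shift_act_dvd.
  rewrite shift_actM; apply: shift_act_dvd => v; rewrite shift_actD shift_act1.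
  by rewrite -['X]/('X^1) shift_actXn addn1 /=; case: (odd v).
have f_a1 u : (2 %| shift_act f (fun v => a v%:R + 1) u)%Z.
  rewrite -(@shift_act_dvd_congr _ _ t) => [|v]; last by rewrite /t; lia.
  by apply: (@dvdz_trans 4); rewrite // -(shift_act_dvd_congr _ _ s_t).
have := annihilator_size_odd iota p_pr p_odd z_prim a_conv a_twist a_sum nz_g mon_f
  (isT : ~~ (2 %| 1)%Z) f_a1.
by rewrite sz_f.
Qed.

End LinearComplexity.

Theorem theorem14 (p : nat) (g : int)
    (p_prime : prime p) (p_odd : odd p)
    (g_odd : ~~ (2 %| g)%Z)
    (g_prim_p : primitive_root_mod p g)
    (g_prim_2p : primitive_root_mod (2 * p) g) :
  ((p%:Z = - 9%:Z %[mod 16])%Z ->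
     is_linear_complexity (quaternary_seq p g) ((p + 1) %/ 2)) /\
  ((p%:Z = 9%:Z %[mod 16])%Z ->
     is_linear_complexity (quaternary_seq p g) ((p + 3) %/ 2)).
Proof.
split=> p16.
  (* The residue -9 is 7 modulo 16. *)
  have -> : ((p + 1) %/ 2 = p./2.+1)%N by lia.
  by apply: linear_complexity_7 => //; lia.
have -> : ((p + 3) %/ 2 = p./2.+2)%N by lia.
by apply: linear_complexity_9 => //; lia.
Qed.
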